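(* Let $G$ be a finite simple graph on $n$ vertices with adjacency matrix $A$. For $k=2$, given the distinct adjacency eigenvalues $\theta_0>\cdots>\theta_d$ of $G$ in decreasing order with their multiplicities $m_0,\ldots,m_d$ (and the minimum and maximum degrees of $G$), the value $$\mu_2(G)=\min_{p\in\mathbb R_2[x]}\ \sum_{\substack{0\le j\le d\\ p(\theta_j)\ge 0}} m_j\quad\text{subject to}\quad (p(A))_{vv}\ge 0\ \text{for all } v\in V(G)$$ can be computed in $\mathcal O(n)$ time.
   Context: $\mathbb R_2[x]$ is the set of real polynomials of degree at most $2$; for $p(x)=a_0+a_1x+a_2x^2$, $p(A)=a_0I+a_1A+a_2A^2$. The preprocessing of computing the spectrum is not counted in the stated running time. *)

(* Defs.v *)
From mathcomp Require Import all_boot all_order all_algebra.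
From mathcomp Require Import reals.

Set Implicit Arguments.
Unset Strict Implicit.
Unset Printing Implicit Defensive.

Import Order.TTheory GRing.Theory Num.Theory.
Local Open Scope ring_scope.

Section Graph.
Variables (V : finType) (E : rel V).

Definition degree (v : V) : nat := #|[set w | E v w]|.

(* The neutral element #|V| is never attained when V is nonempty and E is
   irreflexive, since then every degree is less than #|V|. *)
Definition min_degree : nat := \big[minn/#|V|]_(v : V) degree v.

Definition max_degree : nat := \max_(v : V) degree v.

Definition adjacency (R : realType) : 'M[R]_#|V| :=
  \matrix_(i, j) (E (enum_val i) (enum_val j))%:R.

End Graph.

Section Spectrum.
Variables (R : realType) (n : nat) (A : 'M[R]_n) (d : nat).

Definition distinct_eigenvalues (theta : 'I_d.+1 -> R) : Prop :=
  (forall i j : 'I_d.+1, (i < j)%N -> theta j < theta i) /\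
  (forall x : R, eigenvalue A x <-> exists j, theta j = x).

Definition multiplicities (theta : 'I_d.+1 -> R) (m : 'I_d.+1 -> nat) : Prop :=
  forall j, m j = \rank (eigenspace A (theta j)).

End Spectrum.

Section Mu2.
Variables (R : realType) (V : finType) (E : rel V) (d : nat).
Variables (theta : 'I_d.+1 -> R) (m : 'I_d.+1 -> nat).

(* p(A) for p of degree at most 2; horner_mx is only available for matrices
   whose size is syntactically a successor. *)
Definition eval2_mx n (p : {poly R}) (A : 'M[R]_n) : 'M[R]_n :=
  p`_0 *: 1%:M + p`_1 *: A + p`_2 *: (A *m A).

Definition mu2_feasible (p : {poly R}) : Prop :=
  (size p <= 3)%N /\
  forall v : V,
    0 <= eval2_mx p (adjacency E R) (enum_rank v) (enum_rank v).

Definition mu2_objective (p : {poly R}) : nat :=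
  (\sum_(j < d.+1 | (0 <= p.[theta j])%R) m j)%N.

Definition is_mu2 (mu : nat) : Prop :=
  (exists2 p, mu2_feasible p & mu2_objective p = mu) /\
  (forall p, mu2_feasible p -> (mu <= mu2_objective p)%N).

End Mu2.

(* Unit-cost real RAM: integer and real registers, and one integer and one real
   memory addressed indirectly through integer registers. Integer arithmetic is
   restricted to addition and (truncated) subtraction, and reals cannot be
   rounded to integers; both are the usual precautions against packing a large
   computation into a single unit-cost operation. *)

Inductive instr : Type :=
| Iconst (r k : nat)
| Imove (r a : nat)
| Iadd (r a b : nat)
| Isub (r a b : nat)
| Iload (r a : nat)
| Istore (a b : nat)
| Rofint (r a : nat)
| Rmove (r a : nat)
| Radd (r a b : nat)
| Rsub (r a b : nat)
| Rmul (r a b : nat)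
| Rdiv (r a b : nat)
| Rload (r a : nat)
| Rstore (a b : nat).

Inductive test : Type :=
| Ile (a b : nat)
| Ilt (a b : nat)
| Rle (a b : nat)
| Rlt (a b : nat).

Inductive prog : Type :=
| Skip
| Do (i : instr)
| Seq (p q : prog)
| If (b : test) (p q : prog)
| While (b : test) (p : prog).

Section Machine.
Variable R : realType.

Record state := State {
  ireg : nat -> nat;
  rreg : nat -> R;
  imem : nat -> nat;
  rmem : nat -> R
}.

Definition upd (T : Type) (f : nat -> T) (a : nat) (x : T) : nat -> T :=
  fun b => if b == a then x else f b.

Definition set_ireg (s : state) r x :=
  State (upd (ireg s) r x) (rreg s) (imem s) (rmem s).
Definition set_rreg (s : state) r x :=
  State (ireg s) (upd (rreg s) r x) (imem s) (rmem s).
Definition set_imem (s : state) a x :=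
  State (ireg s) (rreg s) (upd (imem s) a x) (rmem s).
Definition set_rmem (s : state) a x :=
  State (ireg s) (rreg s) (imem s) (upd (rmem s) a x).

(* Division by zero returns 0, as in the library. *)
Definition do_instr (i : instr) (s : state) : state :=
  match i with
  | Iconst r k => set_ireg s r k
  | Imove r a => set_ireg s r (ireg s a)
  | Iadd r a b => set_ireg s r (ireg s a + ireg s b)%N
  | Isub r a b => set_ireg s r (ireg s a - ireg s b)%N
  | Iload r a => set_ireg s r (imem s (ireg s a))
  | Istore a b => set_imem s (ireg s a) (ireg s b)
  | Rofint r a => set_rreg s r (ireg s a)%:R
  | Rmove r a => set_rreg s r (rreg s a)
  | Radd r a b => set_rreg s r (rreg s a + rreg s b)
  | Rsub r a b => set_rreg s r (rreg s a - rreg s b)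
  | Rmul r a b => set_rreg s r (rreg s a * rreg s b)
  | Rdiv r a b => set_rreg s r (rreg s a / rreg s b)
  | Rload r a => set_rreg s r (rmem s (ireg s a))
  | Rstore a b => set_rmem s (ireg s a) (rreg s b)
  end.

Definition do_test (b : test) (s : state) : bool :=
  match b with
  | Ile a b => (ireg s a <= ireg s b)%N
  | Ilt a b => (ireg s a < ireg s b)%N
  | Rle a b => rreg s a <= rreg s b
  | Rlt a b => rreg s a < rreg s b
  end.

(* exec p s t s' : started in s, p halts in s' after exactly t steps, where
   every instruction and every evaluation of a test counts for one step. *)
Inductive exec : prog -> state -> nat -> state -> Prop :=
| exec_skip s : exec Skip s 1 s
| exec_do i s : exec (Do i) s 1 (do_instr i s)
| exec_seq p q s t1 s1 t2 s2 :
    exec p s t1 s1 -> exec q s1 t2 s2 -> exec (Seq p q) s (t1 + t2)%N s2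
| exec_if b p q s t s' :
    exec (if do_test b s then p else q) s t s' -> exec (If b p q) s t.+1 s'
| exec_while_stop b p s : do_test b s = false -> exec (While b p) s 1 s
| exec_while_loop b p s t1 s1 t2 s2 :
    do_test b s = true -> exec p s t1 s1 -> exec (While b p) s1 t2 s2 ->
    exec (While b p) s (t1 + t2).+1 s2.

Lemma exec_det p s t1 s1 t2 s2 :
  exec p s t1 s1 -> exec p s t2 s2 -> t1 = t2 /\ s1 = s2.
Proof.
move=> e1; elim: e1 t2 s2 => {p s t1 s1}
  [s|i s|p q s t1 s1 t2 s2 _ IH1 _ IH2|b p q s t s' _ IH|b p s bF
  |b p s t1 s1 t2 s2 bT _ IH1 _ IH2] t3 s3 e; inversion e; subst => //.
- match goal with H : exec p _ _ _ |- _ => case: (IH1 _ _ H) => *; subst end.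
  by match goal with H : exec q _ _ _ |- _ => case: (IH2 _ _ H) => *; subst end.
- by match goal with H : exec _ _ _ _ |- _ => case: (IH _ _ H) => *; subst end.
- by congruence.
- by congruence.
- match goal with H : exec p _ _ _ |- _ => case: (IH1 _ _ H) => *; subst end.
  by match goal with H : exec (While _ _) _ _ s3 |- _ =>
    case: (IH2 _ _ H) => *; subst end.
Qed.

(* Integer registers 0, 1, 2 hold d, the minimum degree and the maximum degree;
   cell j of the real (resp. integer) memory holds theta_j (resp. m_j) for
   j <= d. Everything else is zero. *)
Definition input (d : nat) (theta : 'I_d.+1 -> R) (m : 'I_d.+1 -> nat)
    (dmin dmax : nat) : state :=
  State (nth 0%N [:: d; dmin; dmax])
        (fun=> 0)
        (fun a => oapp m 0%N (insub a))
        (fun a => oapp theta 0 (insub a)).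

Definition output (s : state) : nat := ireg s 0.

End Machine.

(* Main.v *)
(** For p = a0 + a1 x + a2 x^2 the v-th diagonal entry of p(A) is
    a0 + a2 deg(v), so feasibility only involves the extreme degrees delta and
    Delta.  Up to enlarging it, the set of eigenvalues where a feasible p is
    negative is either an interval theta_i, ..., theta_j with
    theta_i theta_j > - delta (a2 >= 0), or the complement of an open gap
    theta_(i+1), ..., theta_(j-1) with theta_i theta_j < - Delta (a2 < 0), and
    all of these sets occur: take +-(x - theta_i)(x - theta_j) minus the slack
    in the inequality.  Both conditions are monotone in i and j, so two
    two-pointer scans find the heaviest interval and the lightest gap, each
    moving i and j at most 2 (d + 1) times in total; and d + 1 <= n. *)

Require Import Defs.
From mathcomp Require Import all_boot all_order all_algebra.
From mathcomp Require Import reals.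
From mathcomp Require Import zify ring lra.

Set Implicit Arguments.
Unset Strict Implicit.
Unset Printing Implicit Defensive.

Import Order.TTheory GRing.Theory Num.Theory.

(** * Total correctness with time bounds for RAM programs *)

Section Hoare.
Variable R : realType.
Implicit Types (p q : prog) (s : state R) (Q : state R -> Prop).

Definition runs p s (c : nat) Q : Prop :=
  exists t s', [/\ exec p s t s', (t <= c)%N & Q s'].

Lemma runs_leq p s c1 c2 Q : (c1 <= c2)%N -> runs p s c1 Q -> runs p s c2 Q.
Proof.
by move=> c12 [t [s' [e le Qs]]]; exists t, s'; split=> //; apply: leq_trans c12.
Qed.

Lemma runs_seq p q s c1 c2 Q1 Q :
  runs p s c1 Q1 -> (forall s1, Q1 s1 -> runs q s1 c2 Q) ->
  runs (Seq p q) s (c1 + c2) Q.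
Proof.
move=> [t1 [s1 [e1 le1 Q1s]]] /(_ _ Q1s)[t2 [s2 [e2 le2 Qs]]].
by exists (t1 + t2)%N, s2; split=> //; [apply: exec_seq e1 e2|apply: leq_add].
Qed.

(** [mu] is a variant: there are at most [mu s] iterations, each paying [c] for the body and 1 for
    the test, and the failing test costs a final 1. *)
Lemma runs_while b p s c Q (mu : state R -> nat) :
  (forall s1, Q s1 -> do_test b s1 ->
     runs p s1 c (fun s2 => Q s2 /\ (mu s2 < mu s1)%N)) ->
  Q s -> runs (While b p) s (c.+1 * mu s).+1
              (fun s' => Q s' /\ do_test b s' = false).
Proof.
move=> body; have [n] := ubnP (mu s); elim: n s => // n IH s lt_mu Qs.
have [bT|bF] := boolP (do_test b s); last first.
  by exists 1%N, s; split=> //; [apply: exec_while_stop; apply/negbTE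
                                |split=> //; apply/negbTE].
have [t1 [s1 [e1 le1 [Qs1 mu1]]]] := body s Qs bT.
have [|t2 [s2 [e2 le2 Qs2]]] := IH s1 _ Qs1; first by lia.
exists (t1 + t2).+1, s2; split=> //; first exact: exec_while_loop e1 e2.
by nia.
Qed.

(** A loop gets [False]: the calculus covers loop-free code only, and loops go through [runs_while].
    This also makes the value 0 of [wcet] on a loop harmless. *)
Fixpoint wp p Q s : Prop :=
  match p with
  | Skip => Q s
  | Do i => Q (do_instr i s)
  | Seq p q => wp p (wp q Q) s
  | If b p q => if do_test b s then wp p Q s else wp q Q s
  | While _ _ => False
  end.

Fixpoint wcet p : nat :=
  match p with
  | Skip | Do _ => 1
  | Seq p q => wcet p + wcet q
  | If _ p q => (maxn (wcet p) (wcet q)).+1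
  | While _ _ => 0
  end.

Lemma runs_wp p Q s : wp p Q s -> runs p s (wcet p) Q.
Proof.
elim: p Q s => [|i|p IHp q IHq|b p IHp q IHq|//] Q s /=.
- by move=> Qs; exists 1%N, s; split=> //; apply: exec_skip.
- by move=> Qs; exists 1%N, (do_instr i s); split=> //; apply: exec_do.
- by move=> wpp; apply: runs_seq (IHp _ _ wpp) _ => s1; apply: IHq.
- case bE: (do_test b s) => wps; [have {IHq} := IHp _ _ wps|have {IHp} := IHq _ _ wps];
    move=> [t [s' [e le Qs]]];
    exists t.+1, s'; split=> //; try (by apply: exec_if; rewrite bE);
    by rewrite ltnS leq_max le ?orbT.
Qed.

End Hoare.

(** * Sign sets of quadratics on a decreasing sequence *)

Section Quadratics.
Local Open Scope ring_scope.
Variables (R : realType) (d : nat) (th : nat -> R) (mm : nat -> nat).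
Variables dmin dmax : nat.
Hypothesis th_decr : forall i j, (i < j <= d)%N -> th j < th i.
Hypothesis dmin_le_dmax : (dmin <= dmax)%N.

Definition admissible (p : {poly R}) : Prop :=
  [/\ (size p <= 3)%N, 0 <= p`_0 + p`_2 * dmin%:R
    & 0 <= p`_0 + p`_2 * dmax%:R].

Definition cost (p : {poly R}) : nat :=
  (\sum_(0 <= k < d.+1 | (0 <= p.[th k])%R) mm k)%N.

Definition weight (i j : nat) : nat := (\sum_(i <= k < j) mm k)%N.

Definition total : nat := weight 0 d.+1.

(** An inequality suffices: a witness may be cheaper than the bound computed for it, and at the
    optimum the two coincide. *)
Definition attained (b : nat) : Prop := exists2 p, admissible p & (cost p <= b)%N.

Definition inner (i j : nat) : bool := - dmin%:R < th i * th j.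
Definition outer (i j : nat) : bool := th i * th j < - dmax%:R.

Lemma th_antitone i j : (i <= j <= d)%N -> th j <= th i.
Proof.
case/andP; rewrite leq_eqVlt => /predU1P[->//|lt_ij] le_jd.
by apply/ltW/th_decr; rewrite lt_ij.
Qed.

Lemma weight_cat i j k : (i <= j <= k)%N -> (weight i j + weight j k = weight i k)%N.
Proof. by case/andP=> ij jk; rewrite /weight -big_cat_nat. Qed.

Lemma weight_recl i j : (i < j)%N -> (weight i j = mm i + weight i.+1 j)%N.
Proof. exact: big_ltn. Qed.

Lemma weight_recr i j : (i <= j)%N -> (weight i j.+1 = weight i j + mm j)%N.
Proof. exact: big_nat_recr. Qed.

Lemma weight_nil i : weight i i = 0%N.
Proof. exact: big_geq. Qed.

Lemma filtered_le_weight (P : pred nat) i j :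
  (\sum_(i <= k < j | P k) mm k <= weight i j)%N.
Proof. by rewrite /weight big_mkcond; apply: leq_sum => k _; case: (P k). Qed.

Lemma filtered_eq0 (P : pred nat) i j :
  (forall k, (i <= k < j)%N -> ~~ P k) -> (\sum_(i <= k < j | P k) mm k = 0)%N.
Proof.
by move=> nP; rewrite big_nat_cond big1 // => k /andP[/nP/negP].
Qed.

Lemma horner_quadratic (p : {poly R}) x : (size p <= 3)%N ->
  p.[x] = p`_0 + p`_1 * x + p`_2 * x ^+ 2.
Proof.
move=> sp; rewrite (horner_coef_wide x sp) !big_ord_recr big_ord0 /=.
by rewrite add0r expr0 expr1 mulr1.
Qed.

Definition quadratic (a b c : R) : {poly R} := Poly [:: a; b; c].

Lemma quadratic_admissible a b c :
  0 <= a + c * dmin%:R -> 0 <= a + c * dmax%:R -> admissible (quadratic a b c).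
Proof. by move=> h1 h2; split; [exact: size_Poly|rewrite !coef_Poly..]. Qed.

Lemma horner_quadraticE a b c x :
  (quadratic a b c).[x] = a + b * x + c * x ^+ 2.
Proof. by rewrite horner_quadratic ?size_Poly // !coef_Poly. Qed.

Lemma cost_le_total p : (cost p <= total)%N.
Proof. exact: filtered_le_weight. Qed.

Lemma total_attained : attained total.
Proof.
exists (quadratic 0 0 0); last exact: cost_le_total.
by apply: quadratic_admissible; rewrite mul0r addr0.
Qed.

Lemma inner_attained i j : (i <= j <= d)%N -> inner i j ->
  attained (total - weight i j.+1).
Proof.
move=> /andP[ij jd] Pij.
(* This is [(x - th i) (x - th j) - (th i * th j + dmin)]. The subtracted slack is positive by
   [inner], so the values on the whole closed window are strictly negative, and the constraint at
   [dmin] is tight. *)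
exists (quadratic (- dmin%:R) (- (th i + th j)) 1).
  apply: quadratic_admissible; first lra.
  by move: dmin_le_dmax; rewrite -(ler_nat R); lra.
suff le : (cost (quadratic (- dmin%:R) (- (th i + th j)) 1)
           <= weight 0 i + weight j.+1 d.+1)%N.
  have := @weight_cat 0 i d.+1; have := @weight_cat i j.+1 d.+1.
  by rewrite -/total; lia.
rewrite /cost (@big_cat_nat _ _ _ i) /=; [|lia..].
rewrite (@big_cat_nat _ _ _ j.+1 i) /=; [|lia..].
rewrite [X in (_ + (X + _))%N]filtered_eq0 => [|k /andP[ik kj]].
  by rewrite add0n leq_add // filtered_le_weight.
rewrite horner_quadraticE -ltNge.
have := @th_antitone i k; have := @th_antitone k j; rewrite /inner in Pij.
by move=> /(_ ltac:(lia)) h1 /(_ ltac:(lia)) h2; nra.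
Qed.

Lemma outer_attained i j : (i < j <= d)%N -> outer i j ->
  attained (weight i.+1 j).
Proof.
move=> /andP[ij jd] Pij.
(* This is [- (x - th i) (x - th j) + (th i * th j + dmax)], where the last bracket is negative by
   [outer]; the constraint at [dmax] is tight. *)
exists (quadratic (dmax%:R) (th i + th j) (-1)).
  apply: quadratic_admissible; last lra.
  by move: dmin_le_dmax; rewrite -(ler_nat R); lra.
rewrite /cost (@big_cat_nat _ _ _ i.+1) /=; [|lia..].
rewrite (@big_cat_nat _ _ _ j i.+1) /=; [|lia..].
rewrite [X in (X + _)%N]filtered_eq0 => [|k /andP[_ ki]]; last first.
  rewrite horner_quadraticE -ltNge.
  have := @th_antitone k i; have := @th_antitone k j; rewrite /outer in Pij.
  by move=> /(_ ltac:(lia)) h1 /(_ ltac:(lia)) h2; nra.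
rewrite [X in (_ + (_ + X))%N]filtered_eq0 => [|k /andP[jk kd]]; last first.
  rewrite horner_quadraticE -ltNge.
  have := @th_antitone i k; have := @th_antitone j k; rewrite /outer in Pij.
  by move=> /(_ ltac:(lia)) h1 /(_ ltac:(lia)) h2; nra.
by rewrite add0n addn0 filtered_le_weight.
Qed.

(** If the ends of the smaller window have the same strict sign, their product is positive.
    Otherwise [th j' <= 0 <= th i'], and shrinking the window moves both ends towards 0, which
    raises the product. *)
Lemma inner_sub i i' j' j :
  (i <= i')%N -> (i' <= j')%N -> (j' <= j <= d)%N -> inner i j -> inner i' j'.
Proof.
move=> ii ij jj; rewrite /inner => P.
have h1 : th i' <= th i by apply: th_antitone; lia.
have h2 : th j' <= th i' by apply: th_antitone; lia.
have h3 : th j <= th j' by apply: th_antitone; lia.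
have d0 : 0 <= dmin%:R :> R by [].
have [?|?] := ltrP 0 (th j'); first by nra.
have [?|?] := ltrP (th i') 0; first by nra.
have : 0 <= (th i - th i') * - th j by apply: mulr_ge0; lra.
have : 0 <= th i' * (th j' - th j) by apply: mulr_ge0; lra.
by nra.
Qed.

(** A product below [- dmax] forces [th j < 0 < th i], and moving both ends away from 0 lowers the
    product further. *)
Lemma outer_sub i' i j j' :
  (i' <= i)%N -> (i < j)%N -> (j <= j' <= d)%N -> outer i j -> outer i' j'.
Proof.
move=> ii ij jj; rewrite /outer => P.
have h1 : th i <= th i' by apply: th_antitone; lia.
have h2 : th j < th i by apply: th_decr; lia.
have h3 : th j' <= th j by apply: th_antitone; lia.
have d0 : 0 <= dmax%:R :> R by [].
have i0 : 0 < th i by nra.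
have j0 : th j < 0 by nra.
by nra.
Qed.

(** * Lower bounds on the cost of an admissible quadratic *)

Lemma total_le_cost p (N : pred nat) w :
  (forall k, (k <= d)%N -> p.[th k] < 0 -> N k) ->
  (\sum_(0 <= k < d.+1 | N k) mm k <= w)%N -> (total - w <= cost p)%N.
Proof.
move=> sN sw; rewrite leq_subLR (leq_trans _ (leq_add sw (leqnn _))) //.
(* The total splits into the weight of the negative values, at most [w] because [N] contains their
   indices, and the cost itself. *)
rewrite /total /weight (bigID (fun k => p.[th k] < 0)) /=.
apply: leq_add; last first.
  by rewrite /cost eq_leq //; apply: eq_bigl => k; rewrite leNgt.
rewrite big_mkcond [leqRHS]big_mkcond !big_nat leq_sum // => k /andP[_ kd].
by case: ifP => // /sN->.
Qed.

Lemma inner_le_cost p i j : (i <= j <= d)%N ->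
  (forall k, (k <= d)%N -> p.[th k] < 0 -> (i <= k <= j)%N) ->
  (total - weight i j.+1 <= cost p)%N.
Proof.
move=> ijd sN; apply: (total_le_cost sN).
rewrite (@big_cat_nat _ _ _ i) /=; [|lia..].
rewrite (@big_cat_nat _ _ _ j.+1 i) /=; [|lia..].
rewrite [X in (X + _)%N]filtered_eq0 => [|k]; last lia.
rewrite [X in (_ + (_ + X))%N]filtered_eq0 => [|k]; last lia.
by rewrite add0n addn0 filtered_le_weight.
Qed.

Lemma outer_le_cost p i j : (i < j <= d)%N ->
  (forall k, (k <= d)%N -> p.[th k] < 0 -> (k <= i)%N || (j <= k)%N) ->
  (weight i.+1 j <= cost p)%N.
Proof.
move=> ijd sN; rewrite /cost.
rewrite (@big_cat_nat _ _ _ i.+1) /=; [|lia..].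
rewrite (@big_cat_nat _ _ _ j i.+1) /=; [|lia..].
rewrite addnCA (leq_trans _ (leq_addr _ _)) // /weight [leqRHS]big_mkcond !big_nat.
apply: leq_sum => k kij; rewrite leNgt; case: ifP => // /negbFE /sN.
lia.
Qed.

(* Two values of [q = a + b x + c x^2] combine to
   [u q(v) - v q(u) = (u - v) (a - c u v)], which eliminates [b]. *)
Lemma inner_sign (a b c u v e : R) : 0 <= e -> 0 <= c -> 0 <= a + c * e ->
  v <= u -> a + b * u + c * u ^+ 2 < 0 -> a + b * v + c * v ^+ 2 < 0 ->
  - e < u * v.
Proof.
move=> e0 c0 ace vu qu qv.
have [v0|v0] := ltrP 0 v; first by nra.
have [u0|u0] := ltrP u 0; first by nra.
(* Now [v <= 0 <= u]. If they coincide both are 0, so [a < 0], and [0 <= a + c * e] forces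
   [0 < e]. *)
have [uv|uv] := eqVneq u v.
  have u00 : u = 0 by lra.
  by move: qu qv; rewrite -uv u00 !mulr0 !addr0 => qu _; nra.
have {uv} ltvu : v < u by rewrite lt_neqAle eq_sym uv.
have h : (u - v) * (a - c * (u * v)) < 0.
  have -> : (u - v) * (a - c * (u * v)) =
     u * (a + b * v + c * v ^+ 2) - v * (a + b * u + c * u ^+ 2) by ring.
  have [u00|u00] := eqVneq u 0; last first.
    have up : 0 < u by rewrite lt_neqAle eq_sym u00.
    have : u * (a + b * v + c * v ^+ 2) < 0 by rewrite pmulr_rlt0.
    have : 0 <= v * (a + b * u + c * u ^+ 2) by rewrite mulr_le0 // ltW.
    by lra.
  have vn : v < 0 by lra.
  have : 0 < v * (a + b * u + c * u ^+ 2) by rewrite nmulr_rgt0.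
  by rewrite [in u * _]u00 mul0r; lra.
have h2 : a - c * (u * v) < 0 by move: h; rewrite pmulr_rlt0 //; lra.
have h3 : 0 < c * (u * v + e) by lra.
have : 0 < u * v + e.
  rewrite ltNge; apply/negP => h4; have := mulr_ge0_le0 c0 h4; lra.
by lra.
Qed.

(** The same elimination of [b] gives [0 < c * (u * v + e)]; the negative sign of [c] now reverses
    the conclusion. *)
Lemma outer_sign (a b c u v e : R) : c < 0 -> 0 <= a + c * e ->
  v < 0 -> 0 < u -> a + b * u + c * u ^+ 2 < 0 -> a + b * v + c * v ^+ 2 < 0 ->
  u * v < - e.
Proof.
move=> c0 ace v0 u0 qu qv.
have h : (u - v) * (a - c * (u * v)) < 0.
  have -> : (u - v) * (a - c * (u * v)) =
     u * (a + b * v + c * v ^+ 2) - v * (a + b * u + c * u ^+ 2) by ring.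
  have : u * (a + b * v + c * v ^+ 2) < 0 by rewrite pmulr_rlt0.
  have : 0 < v * (a + b * u + c * u ^+ 2) by rewrite nmulr_rgt0.
  by lra.
have h2 : a - c * (u * v) < 0 by move: h; rewrite pmulr_rlt0 //; lra.
have : 0 < c * (u * v + e) by lra.
by rewrite nmulr_rgt0 //; lra.
Qed.

Lemma bounded_pred_cases (N : pred nat) : (forall k, N k -> (k <= d)%N) ->
  (exists k, N k) \/ (forall k, ~~ N k).
Proof.
move=> Nd; have [/hasP[k _ Nk]|/hasPn noN] := boolP (has N (iota 0 d.+1)).
  by left; exists k.
right=> k; apply/negP => Nk; have := noN k.
by rewrite mem_iota ltnS Nd // Nk => /(_ isT).
Qed.

Lemma cost_cases p : admissible p ->
  [\/ (total <= cost p)%N,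
      exists i j, [/\ (i <= j <= d)%N, inner i j & (total - weight i j.+1 <= cost p)%N]
    | exists i j, [/\ (i < j <= d)%N, outer i j & (weight i.+1 j <= cost p)%N]].
Proof.
move=> [sp pmin pmax].
pose N k := (k <= d)%N && (p.[th k] < 0).
have NE k : N k -> p`_0 + p`_1 * th k + p`_2 * th k ^+ 2 < 0.
  by move=> /andP[_]; rewrite horner_quadratic.
have dm0 : 0 <= dmin%:R :> R by [].
have dM0 : 0 <= dmax%:R :> R by [].
have ubN (Z : pred nat) k : N k && Z k -> (k <= d)%N by case/andP=> /andP[].
have [[k0 Nk0]|noN] := @bounded_pred_cases N (fun k Nk => proj1 (andP Nk)); last first.
  constructor 1; rewrite -[total]subn0; apply: (@total_le_cost _ pred0).
    by move=> k kd pk; have := noN k; rewrite /N kd pk.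
  by rewrite big_pred0.
(* When the leading coefficient is nonnegative, the window runs from the first to the last index of
   a negative value; these may coincide. *)
have [p2lt0|p2ge0] := ltrP p`_2 0; last first.
  have exN : exists k, N k && predT k by exists k0; rewrite Nk0.
  case: (ex_minnP exN) => i /andP[Ni _] mini.
  case: (ex_maxnP exN (@ubN predT)) => j /andP[Nj _] maxj.
  have ijd : (i <= j <= d)%N.
    by rewrite mini ?Nj //=; case/andP: Nj.
  constructor 2; exists i, j; split=> //; last first.
    by apply: inner_le_cost => // k kd pk; rewrite mini ?maxj // /N kd pk.
  exact: inner_sign dm0 p2ge0 pmin (th_antitone ijd) (NE _ Ni) (NE _ Nj).
(* From here [p] is strictly concave and nonnegative at 0, so every index in [N] has [th k] of
   strict sign. When both signs occur, the gap lies between the last positive and the first negative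
   such index. *)
have p00 : 0 <= p`_0 by nra.
pose pos k := 0 < th k; pose neg k := th k < 0.
have sgN k : N k -> pos k || neg k.
  move=> /NE q; rewrite /pos /neg; have [//|//|k0E] := ltgtP 0 (th k).
  by exfalso; move: q; rewrite -k0E; lra.
have [[kp Nkp]|noP] := bounded_pred_cases (@ubN pos).
- have exP : exists k, N k && pos k by exists kp.
  case: (ex_maxnP exP (@ubN pos)) => i /andP[Ni pi] maxi.
  have id : (i <= d)%N by case/andP: Ni.
  have [[kn Nkn]|noNeg] := bounded_pred_cases (@ubN neg).
  + have exM : exists k, N k && neg k by exists kn.
    case: (ex_minnP exM) => j /andP[Nj nj] minj.
    have jd : (j <= d)%N by case/andP: Nj.
    have ij : (i < j)%N.
      rewrite ltnNge; apply/negP => ji; have := @th_antitone j i.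
      by rewrite ji id => /(_ isT); move: pi nj; rewrite /pos /neg; lra.
    constructor 3; exists i, j; split=> //; first by rewrite ij.
      exact: outer_sign p2lt0 pmax nj pi (NE _ Ni) (NE _ Nj).
    apply: outer_le_cost => [|k kd pk]; first by rewrite ij.
    have Nk : N k by rewrite /N kd.
    apply/orP; case/orP: (sgN k Nk) => sk; [left; apply: maxi|right; apply: minj];
      exact/andP.
  + have allP k : N k -> pos k.
      move=> Nk; have := noNeg k; have := sgN k Nk; rewrite Nk /=.
      by case: (pos k) => //= ->.
    (* Only positive [th k] give negative values. The initial window up to [i] then has positive
       ends, hence a positive product, and is [inner] even though [p] is concave. The final window
       from [j] to [d] is treated likewise below. *)
    constructor 2; exists 0%N, i; split=> //; last first.
      apply: inner_le_cost => // k kd pk; apply: maxi.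
      have Nk : N k by rewrite /N kd.
      by rewrite Nk allP.
    have := @th_antitone 0 i id; move: pi; rewrite /inner /pos.
    move=> ? ?; have : 0 < th 0%N * th i by apply: mulr_gt0; lra.
    by lra.
- have allN k : N k -> neg k.
    move=> Nk; have := noP k; have := sgN k Nk; rewrite Nk /=.
    by case: (pos k).
  have exM : exists k, N k && neg k by exists k0; rewrite Nk0 allN.
  case: (ex_minnP exM) => j /andP[Nj nj] minj.
  have jd : (j <= d)%N by case/andP: Nj.
  constructor 2; exists j, d; split; first by rewrite jd /=.
  + have := @th_antitone j d; rewrite jd leqnn => /(_ isT).
    move: nj; rewrite /inner /neg => ? ?.
    have : 0 < th j * th d by rewrite nmulr_rgt0 //; lra.
    by lra.
  + apply: inner_le_cost => [|k kd pk]; first by rewrite jd /=.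
    have Nk : N k by rewrite /N kd.
    by rewrite kd andbT; apply: minj; rewrite Nk allN.
Qed.

(** * Invariants of the two-pointer scans *)

(* The search for the heaviest [inner] interval: the current window is
   [i, ..., j - 1], and no [inner] interval ending at [j] or later starts
   before [i]. *)
Definition inner_scan (i j b : nat) : Prop :=
  [/\ (i <= j <= d.+1)%N, attained b, (b <= total)%N,
      (forall i' j', (i' <= j' <= d)%N -> (j' < j)%N -> inner i' j' ->
         (b <= total - weight i' j'.+1)%N)
    & (forall i' j', (i' <= j' <= d)%N -> (j <= j')%N -> inner i' j' ->
         (i <= i')%N)].

Lemma inner_scan0 : inner_scan 0 0 total.
Proof. by split=> //; apply: total_attained. Qed.

(** Every [inner] interval ending at [j] starts at [i] or later, so the window up to [j] is the
    heaviest of them and the only one to record. *)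
Lemma inner_scan_right i j b : inner_scan i j b -> (j <= d)%N -> inner i j ->
  inner_scan i j.+1 (minn b (total - weight i j.+1)).
Proof.
move=> [ijd ab bT lo hi] jd Pij; split=> //; first lia.
- have ac : attained (total - weight i j.+1) by apply: inner_attained; [lia|].
  by rewrite /minn; case: ifP.
- by rewrite geq_min bT.
- move=> i' j' ijd' lej Pij'.
  have [ltj|gej] := ltnP j' j; first by rewrite geq_min lo.
  have jE : j' = j by lia.
  subst j'; have ii := hi _ _ ijd' (leqnn _) Pij'.
  have := @weight_cat i i' j.+1; lia.
- by move=> i' j' ijd' lej; apply: hi => //; lia.
Qed.

(** By [inner_sub], no [inner] interval starting at [i] can reach [j] or beyond, so [i] is
    discarded. The maximum pushes [j] along when the window is empty. *)
Lemma inner_scan_left i j b : inner_scan i j b -> (j <= d)%N -> ~~ inner i j ->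
  inner_scan i.+1 (maxn j i.+1) b.
Proof.
move=> [ijd ab bT lo hi] jd nPij; split=> //; first lia.
- move=> i' j' ijd' lej Pij'.
  have [ltj|gej] := ltnP j' j; first exact: lo.
  (* An end [j'] in the newly covered range exists only when [i = j]; the interval is then the
     singleton just rejected. *)
  have i'E : i' = i by have := hi _ _ ijd' gej Pij'; lia.
  have j'E : j' = j by lia.
  by rewrite i'E j'E (negbTE nPij) in Pij'.
- move=> i' j' ijd' lej Pij'; have jj : (j <= j')%N by lia.
  have := hi _ _ ijd' jj Pij'; rewrite leq_eqVlt => /predU1P[i'E|//].
  case/negP: nPij; apply: inner_sub Pij'; lia.
Qed.

(* The search for the lightest complement [i + 1, ..., j - 1] of an [outer]
   pair. *)
Definition outer_scan (i j b : nat) : Prop :=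
  [/\ (i < j)%N, attained b,
      (forall i' j', (i' < j' <= d)%N -> (i' < i)%N -> outer i' j' ->
         (b <= weight i'.+1 j')%N)
    & (forall i' j', (i' < j' <= d)%N -> (i <= i')%N -> outer i' j' ->
         (j <= j')%N)].

Lemma outer_scan0 b : attained b -> outer_scan 0 1 b.
Proof. by split=> // i' j' ijd' _ _; lia. Qed.

(** The invariant makes [j] the least possible partner of [i], so this gap is the lightest one with
    left end [i]. The maximum keeps the pointers in strict order. *)
Lemma outer_scan_left i j b : outer_scan i j b -> (j <= d)%N -> outer i j ->
  outer_scan i.+1 (maxn j i.+2) (minn b (weight i.+1 j)).
Proof.
move=> [ij ab lo hi] jd Pij; split; first lia.
- have ac : attained (weight i.+1 j) by apply: outer_attained; [lia|].
  by rewrite /minn; case: ifP.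
- move=> i' j' ijd' lei Pij'.
  have [lti|gei] := ltnP i' i; first by rewrite geq_min lo.
  have iE : i' = i by lia.
  subst i'; have jj := hi _ _ ijd' (leqnn _) Pij'.
  have := @weight_cat i.+1 j j'; lia.
- by move=> i' j' ijd' lei Pij'; have := hi _ _ ijd' _ Pij'; lia.
Qed.

(** By [outer_sub], an [outer] pair with right end [j] and left end at least [i] would make the
    rejected pair [outer] too. *)
Lemma outer_scan_right i j b : outer_scan i j b -> (j <= d)%N -> ~~ outer i j ->
  outer_scan i j.+1 b.
Proof.
move=> [ij ab lo hi] jd nPij; split=> //; first lia.
move=> i' j' ijd' lei Pij'; have := hi _ _ ijd' lei Pij'.
rewrite leq_eqVlt => /predU1P[j'E|//].
by case/negP: nPij; apply: outer_sub Pij'; lia.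
Qed.

Lemma scans_optimal i i' j j' b b' :
  inner_scan i j b -> (d < j)%N -> outer_scan i' j' b' -> (d < j')%N ->
  (b' <= b)%N -> attained b' /\ forall p, admissible p -> (b' <= cost p)%N.
Proof.
move=> [_ _ bT lo _] dj [_ ab lo' hi'] dj' b'b; split=> // p /cost_cases.
case=> [le|[k [l [kl P le]]]|[k [l [kl P le]]]].
- by lia.
- by have := lo _ _ kl _ P; lia.
- have [ki|ik] := ltnP k i'; first by have := lo' _ _ kl ki P; lia.
  (* A pair whose left end was not yet processed would need a right end of at least [j'], which
     exceeds [d]. *)
  by have := hi' _ _ kl ik P; lia.
Qed.

End Quadratics.

(** * The RAM program, its loop invariants and its running time *)

Section Algorithm.
Local Notation "p ;; q" := (Seq p q) (at level 60, right associativity).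

(* Integer registers: 0 = d, 1 = minimum degree, 2 = maximum degree, 3 = i,
   4 = j, 5 = weight of the current window, 6 = best value, 7 = total weight,
   8 = the constant 1, 9 = scratch.  Real registers: 0-2 = scratch, 3 = the
   threshold for theta_i * theta_j, 4 = the constant 0. *)
Definition sum_body : prog :=
  Do (Iload 9 3) ;; Do (Iadd 7 7 9) ;; Do (Iadd 3 3 8).

Definition load_product : prog :=
  Do (Rload 0 3) ;; Do (Rload 1 4) ;; Do (Rmul 2 0 1).

Definition inner_body : prog :=
  load_product ;;
  If (Rlt 3 2)
    (Do (Iload 9 4) ;; Do (Iadd 5 5 9) ;; Do (Iadd 4 4 8) ;;
     Do (Isub 9 7 5) ;; If (Ilt 9 6) (Do (Imove 6 9)) Skip)
    (Do (Iload 9 3) ;; Do (Isub 5 5 9) ;; Do (Iadd 3 3 8) ;;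
     If (Ilt 4 3) (Do (Imove 4 3)) Skip).

Definition outer_body : prog :=
  load_product ;;
  If (Rlt 2 3)
    (If (Ilt 5 6) (Do (Imove 6 5)) Skip ;;
     Do (Iadd 3 3 8) ;; Do (Iload 9 3) ;; Do (Isub 5 5 9) ;;
     If (Ile 4 3) (Do (Iadd 4 3 8)) Skip)
    (Do (Iload 9 4) ;; Do (Iadd 5 5 9) ;; Do (Iadd 4 4 8)).

Definition inner_init : prog :=
  Do (Imove 6 7) ;; Do (Iconst 3 0) ;; Do (Rofint 3 1) ;; Do (Rsub 3 4 3).

Definition outer_init : prog :=
  Do (Iconst 3 0) ;; Do (Iconst 4 1) ;; Do (Iconst 5 0) ;;
  Do (Rofint 3 2) ;; Do (Rsub 3 4 3).

Definition mu2_prog : prog :=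
  Do (Iconst 8 1) ;; While (Ile 3 0) sum_body ;;
  inner_init ;; While (Ile 4 0) inner_body ;;
  outer_init ;; While (Ile 4 0) outer_body ;;
  Do (Imove 0 6).

Local Open Scope ring_scope.
Variables (R : realType) (d : nat) (th : nat -> R) (mm : nat -> nat).
Variables dmin dmax : nat.
Hypothesis th_decr : forall i j, (i < j <= d)%N -> th j < th i.
Hypothesis dmin_le_dmax : (dmin <= dmax)%N.

Local Notation weight := (weight mm).
Local Notation total := (total d mm).
Local Notation inner_scan := (inner_scan d th mm dmin dmax).
Local Notation outer_scan := (outer_scan d th mm dmin dmax).

(** Scratch registers are left free. Stating the integer registers as one list equation lets an
    injection pattern yield all nine equations at once. *)
Definition stores (s : state R) (i j w b T : nat) (e : R) : Prop :=
  [/\ [seq ireg s k | k <- iota 0 9] = [:: d; dmin; dmax; i; j; w; b; T; 1]%N,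
      rreg s 3 = e, rreg s 4 = 0, imem s = mm & rmem s = th].

(** The common variant of both scans: no pointer moves back and each iteration advances at least
    one. It never exceeds [d.+2 + d.+1], whence linear time. *)
Definition pointers_left (s : state R) : nat :=
  ((d.+2 - ireg s 3) + (d.+1 - ireg s 4))%N.

Definition sum_inv (s : state R) : Prop :=
  exists2 i, (i <= d.+1)%N & stores s i 0 0 0 (weight 0 i) 0.

Definition inner_inv (s : state R) : Prop :=
  exists i j b, stores s i j (weight i j) b total (- dmin%:R) /\
    inner_scan i j b.

(** [b0] is the result of the inner scan; carrying [b <= b0] makes the final value the better of
    both scans. *)
Definition outer_inv (b0 : nat) (s : state R) : Prop :=
  exists i j b, [/\ stores s i j (weight i.+1 j) b total (- dmax%:R),
    outer_scan i j b & (b <= b0)%N].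

Lemma sum_body_correct s : sum_inv s -> do_test (Ile 3 0) s ->
  runs sum_body s (wcet sum_body)
    (fun s' => sum_inv s' /\ (d.+1 - ireg s' 3 < d.+1 - ireg s 3)%N).
Proof.
move=> [i id [[r0 r1 r2 r3 r4 r5 r6 r7 r8] e3 e4 em et]] /=; rewrite r3 r0 => lt_id.
apply: runs_wp => /=; rewrite /upd /= r3 r7 r8 em; split; last by lia.
exists i.+1 => //; split=> //=.
by rewrite /upd /= ?r0 ?r1 ?r2 ?r3 ?r4 ?r5 ?r6 ?r7 ?r8 ?em weight_recr // addn1.
Qed.

Lemma inner_body_correct s : inner_inv s -> do_test (Ile 4 0) s ->
  runs inner_body s (wcet inner_body)
    (fun s' => inner_inv s' /\ (pointers_left s' < pointers_left s)%N).
Proof.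
move=> [i [j [b [[[r0 r1 r2 r3 r4 r5 r6 r7 r8] e3 e4 em et] sc]]]] /=.
rewrite r4 r0 => lt_jd; have [ijd _ _ _ _] := sc.
apply: runs_wp => /=; rewrite /pointers_left /upd /= r3 r4 e3 et.
case: ifP => [Pij|/negbT nPij].
- have sc' := inner_scan_right th_decr dmin_le_dmax sc lt_jd Pij.
  have wE : (weight i j + mm j = weight i j.+1)%N by rewrite weight_recr //; lia.
  rewrite /= ?r3 ?r4 ?r5 ?r6 ?r7 ?r8 ?em ?wE ?addn1.
  case: ifP => lt_b; split; rewrite /upd /= ?r3 ?r4 ?r8 ?addn1; try lia.
  + exists i, j.+1, (total - weight i j.+1)%N; split; last first.
      by move: sc'; rewrite (minn_idPr _) // ltnW.
    by split=> //=; rewrite /upd /= ?r0 ?r1 ?r2 ?r3 ?r4 ?r5 ?r6 ?r7 ?r8 ?em ?wE ?addn1.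
  + exists i, j.+1, b; split; last first.
      by move: sc'; rewrite (minn_idPl _) // leqNgt lt_b.
    by split=> //=; rewrite /upd /= ?r0 ?r1 ?r2 ?r3 ?r4 ?r5 ?r6 ?r7 ?r8 ?em ?wE ?addn1.
- have sc' := inner_scan_left th_decr dmin_le_dmax sc lt_jd nPij.
  rewrite /= ?r3 ?r4 ?r5 ?r8 ?em ?addn1.
  case: ifP => lt_ij; split; rewrite /upd /= ?r3 ?r4 ?r8 ?addn1; try lia.
  + exists i.+1, i.+1, b; split; last first.
      by move: sc'; rewrite (maxn_idPr _) // ltnW.
    (* The window was empty: truncated subtraction keeps its weight at 0, which is right for the new
       empty window at [i.+1]. *)
    have ijE : i = j by lia.
    split=> //=; rewrite /upd /= ?r0 ?r1 ?r2 ?r3 ?r4 ?r5 ?r6 ?r7 ?r8 ?em ?addn1.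
    by rewrite ijE !weight_nil sub0n.
  + exists i.+1, j, b; split; last first.
      by move: sc'; rewrite (maxn_idPl _) // leqNgt lt_ij.
    split=> //=; rewrite /upd /= ?r0 ?r1 ?r2 ?r3 ?r4 ?r5 ?r6 ?r7 ?r8 ?em ?addn1.
    by rewrite [weight i j]weight_recl ?addKn //; lia.
Qed.

Lemma outer_body_correct b0 s : outer_inv b0 s -> do_test (Ile 4 0) s ->
  runs outer_body s (wcet outer_body)
    (fun s' => outer_inv b0 s' /\ (pointers_left s' < pointers_left s)%N).
Proof.
move=> [i [j [b [[[r0 r1 r2 r3 r4 r5 r6 r7 r8] e3 e4 em et] sc lb]]]] /=.
rewrite r4 r0 => lt_jd; have [ij _ _ _] := sc.
apply: runs_wp => /=; rewrite /pointers_left /upd /= r3 r4 e3 et.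
case: ifP => [Pij|/negbT nPij].
- have sc' := outer_scan_left th_decr dmin_le_dmax sc lt_jd Pij.
  (* When [j = i.+1] the gap is empty and truncated subtraction keeps 0, the weight of the empty gap
     after [j] moves to [i.+2]. *)
  have wE : (weight i.+1 j - mm i.+1 = weight i.+2 (maxn j i.+2))%N.
    have [ij1|ij1] := ltnP i.+1 j.
      by rewrite (maxn_idPl _) // weight_recl // addKn.
    have -> : j = i.+1 by lia.
    by rewrite (maxn_idPr _) // !weight_nil sub0n.
  rewrite /= ?r5 ?r6.
  have bE : (if (weight i.+1 j < b)%N then weight i.+1 j else b) =
            minn b (weight i.+1 j) by rewrite minnC.
  case: ifP bE => lt_b bE; rewrite /= ?r3 ?r4 ?r5 ?r8 ?em ?addn1;
    case: ifP => lt_ij; split; rewrite /upd /= ?r3 ?r4 ?r8 ?addn1; try lia;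
    exists i.+1, (maxn j i.+2), (minn b (weight i.+1 j)); split=> //; try lia;
    split=> //=; rewrite /upd /= ?r0 ?r1 ?r2 ?r3 ?r4 ?r5 ?r6 ?r7 ?r8 ?em ?addn1 ?wE -?bE //;
    do 4 congr (_ :: _); congr (_ :: _); lia.
- have sc' := outer_scan_right th_decr dmin_le_dmax sc lt_jd nPij.
  split; rewrite /upd /= ?r3 ?r4 ?r8 ?addn1; last by lia.
  exists i, j.+1, b; split=> //.
  split=> //=; rewrite /upd /= ?r0 ?r1 ?r2 ?r3 ?r4 ?r5 ?r6 ?r7 ?r8 ?em ?addn1.
  by rewrite weight_recr.
Qed.

(** The hypothesis describes the state after the first instruction, which loads the constant 1. *)
Lemma mu2_prog_correct (s : state R) : stores (set_ireg s 8 1) 0 0 0 0 0 0 ->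
  runs mu2_prog s (100 * d.+1) (fun s' =>
    attained d th mm dmin dmax (output s') /\
    forall p, admissible dmin dmax p -> (output s' <= cost d th mm p)%N).
Proof.
move=> st0.
have lt_sum : (wcet sum_body).+1 = 4%N by [].
have lt_inner : (wcet inner_body).+1 = 11%N by [].
have lt_outer : (wcet outer_body).+1 = 12%N by [].
have left_le s1 : (pointers_left s1 <= d.+2 + d.+1)%N.
  by rewrite /pointers_left; lia.
(* The coefficients 4, 11 and 12 are the costs of one iteration of each loop, test included; the sum
   is [50 * d + 87]. *)
apply: (@runs_leq _ _ _ (1 + ((4 * d.+1).+1 + (4 + ((11 * (d.+2 + d.+1)).+1 +
         (5 + ((12 * (d.+2 + d.+1)).+1 + 1))))))); first by lia.
apply: (@runs_seq _ _ _ _ _ _ sum_inv) => [|s1 inv1].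
  by apply: (@runs_wp _ (Do _)); exists 0%N => //=; rewrite weight_nil.
have sumR := runs_while sum_body_correct inv1.
apply: runs_seq (runs_leq _ sumR) _ => [|s2 /= [[i id [[r0 r1 r2 r3 r4 r5 r6 r7 r8] e3 e4 em et]]]].
  by rewrite lt_sum; lia.
rewrite r3 r0 => /negbT; rewrite -ltnNge => di.
have {di id} iE : i = d.+1 by lia.
apply: (@runs_seq _ _ _ _ _ _ inner_inv) => [|s3 inv3].
  apply: (@runs_wp _ inner_init); exists 0%N, 0%N, total.
  split; last exact: inner_scan0.
  split=> //=; rewrite /upd /= ?sub0r ?e4 ?r1 ?sub0r //.
  by rewrite r0 r2 r4 r5 r7 r8 weight_nil iE.
have innerR := runs_while inner_body_correct inv3.
apply: runs_seq (runs_leq _ innerR) _ => [|s4 /= [[i4 [j4 [b4 [[[q0 q1 q2 q3 q4 q5 q6 q7 q8] f3 f4 fm ft] sc4]]]]]].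
  by rewrite lt_inner; have := left_le s3; lia.
rewrite q4 q0 => /negbT; rewrite -ltnNge => dj4.
apply: (@runs_seq _ _ _ _ _ _ (outer_inv b4)) => [|s5 inv5].
  apply: (@runs_wp _ outer_init); exists 0%N, 1%N, b4.
  split=> //; last by apply: outer_scan0; case: sc4.
  split=> //=; rewrite /upd /= ?f4 ?q2 ?sub0r //.
  by rewrite q0 q1 q6 q7 q8 weight_nil.
have outerR := runs_while (@outer_body_correct b4) inv5.
apply: runs_seq (runs_leq _ outerR) _ => [|s6 /= [[i6 [j6 [b6 [[[p0 p1 p2 p3 p4 p5 p6 p7 p8] g3 g4 gm gt] sc6 lb]]]]]].
  by rewrite lt_outer; have := left_le s5; lia.
rewrite p4 p0 => /negbT; rewrite -ltnNge => dj6.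
apply: (@runs_wp _ (Do _)); rewrite /output /= /upd /= p6.
exact: scans_optimal sc4 dj4 sc6 dj6 lb.
Qed.

End Algorithm.

(** * Degrees, diagonal entries and the number of distinct eigenvalues *)

Section Graph.
Local Open Scope ring_scope.
Variables (R : realType) (V : finType) (E : rel V).

Lemma min_degree_le v : (min_degree E <= degree E v)%N.
Proof.
rewrite /min_degree; elim: (index_enum V) (mem_index_enum v) => // w s IH.
rewrite inE big_cons => /predU1P[<-|/IH le]; rewrite geq_min ?leqnn //.
by rewrite le orbT.
Qed.

Lemma min_degree_attained (v0 : V) : exists v, degree E v = min_degree E.
Proof.
pose v := [arg min_(v < v0) degree E v]; exists v; apply/eqP.
rewrite eqn_leq min_degree_le andbT /v; case: arg_minnP => // w _ minw.
(* The neutral element [#|V|] must be compared too; it bounds every degree. *)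
rewrite /min_degree; elim/big_ind: _ => [|x y wx wy|u _]; first exact: max_card.
- by rewrite leq_min wx.
- exact: minw.
Qed.

Lemma max_degree_attained (v0 : V) : exists v, degree E v = max_degree E.
Proof.
by rewrite /max_degree; have [|v ->] := @bigop.eq_bigmax V (degree E); [apply/card_gt0P; exists v0|exists v].
Qed.

Lemma le_max_degree v : (degree E v <= max_degree E)%N.
Proof. exact: leq_bigmax. Qed.

(** Irreflexivity removes the linear term, and by symmetry the diagonal entry of the square counts
    the neighbours of [v]. *)
Lemma eval2_mx_diag (p : {poly R}) v : symmetric E -> irreflexive E ->
  eval2_mx p (adjacency E R) (enum_rank v) (enum_rank v) =
  p`_0 + p`_2 * (degree E v)%:R.
Proof.
move=> symE irrE; rewrite /eval2_mx !mxE eqxx enum_rankK irrE mulr1 mulr0 addr0.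
congr (_ + _ * _).
transitivity (\sum_(w : V) (E v w)%:R : R).
  rewrite (reindex (@enum_rank V)) /=; last exact/onW_bij/enum_rank_bij.
  apply: eq_bigr => w _; rewrite !mxE !enum_rankK (symE w) -natrM.
  by case: (E v w).
by rewrite -natr_sum /degree -sum1dep_card [in RHS]big_mkcond.
Qed.

(** An affine function of the degree is nonnegative on an interval once it is so at both ends; [v0]
    ensures that the extreme degrees are attained. *)
Lemma feasible_admissible (p : {poly R}) (v0 : V) : symmetric E -> irreflexive E ->
  mu2_feasible E p <-> admissible (min_degree E) (max_degree E) p.
Proof.
move=> symE irrE; split=> [[sp ge0]|[sp gemin gemax]].
  have ge v : 0 <= p`_0 + p`_2 * (degree E v)%:R by rewrite -eval2_mx_diag.
  have [v1 <-] := min_degree_attained v0; have [v2 <-] := max_degree_attained v0.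
  by split.
split=> // v; rewrite eval2_mx_diag //.
have : (min_degree E)%:R <= (degree E v)%:R :> R by rewrite ler_nat min_degree_le.
have : (degree E v)%:R <= (max_degree E)%:R :> R by rewrite ler_nat le_max_degree.
by have [?|?] := ltrP p`_2 0; nra.
Qed.

(** The [d.+1] eigenvalues are distinct roots of the characteristic polynomial, of degree [n]. This
    turns a bound linear in [d] into one linear in [n]. *)
Lemma distinct_eigenvalues_card (n d : nat) (A : 'M[R]_n) (theta : 'I_d.+1 -> R) :
  distinct_eigenvalues A theta -> (d < n)%N.
Proof.
move=> [decr eig]; rewrite -ltnS -(size_char_poly A).
have -> : d.+1 = size [seq theta j | j <- enum 'I_d.+1].
  by rewrite size_map size_enum_ord.
apply: max_poly_roots; first by rewrite monic_neq0 ?char_poly_monic.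
  apply/allP => _ /mapP[j _ ->]; rewrite -eigenvalue_root_char.
  by apply/eig; exists j.
rewrite map_inj_uniq ?enum_uniq // => i j tij; apply/val_inj/eqP.
by case: ltngtP => // /decr; rewrite tij ltxx.
Qed.

End Graph.

Theorem theorem4p6 (R : realType) :
  exists (P : prog) (C : nat),
    forall (V : finType) (E : rel V),
      symmetric E -> irreflexive E ->
    forall (d : nat) (theta : 'I_d.+1 -> R) (m : 'I_d.+1 -> nat),
      distinct_eigenvalues (adjacency E R) theta ->
      multiplicities (adjacency E R) theta m ->
    exists (t : nat) (s : state R),
      [/\ exec P (input theta m (min_degree E) (max_degree E)) t s,
          (t <= C * #|V|)%N
        & is_mu2 E theta m (output s)].
Proof.
exists mu2_prog, 100%N => V E symE irrE d theta m eig mult.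
have dV := distinct_eigenvalues_card eig; have [decr _] := eig.
have [v0 _] : exists v : V, v \in V by apply/card_gt0P; apply: leq_ltn_trans dV.
(* The default 0 beyond [d] agrees with the memories of [input] cell by cell. *)
pose th k : R := oapp theta 0%R (insub k).
pose mm k : nat := oapp m 0%N (insub k).
have thE (j : 'I_d.+1) : th j = theta j by rewrite /th valK.
have mmE (j : 'I_d.+1) : mm j = m j by rewrite /mm valK.
have th_decr i j : (i < j <= d)%N -> (th j < th i)%R.
  move=> /andP[ij jd]; have jd1 : (j < d.+1)%N by [].
  have id1 : (i < d.+1)%N by exact: ltn_trans ij _.
  by rewrite (thE (Ordinal jd1)) (thE (Ordinal id1)) decr.
have le_deg : (min_degree E <= max_degree E)%N.
  exact: leq_trans (min_degree_le E v0) (le_max_degree E v0).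
have costE p : cost d th mm p = mu2_objective theta m p.
  rewrite /cost /mu2_objective big_mkord.
  by apply: eq_big => j *; rewrite ?thE ?mmE.
have [|t [s [ex le_t [[p adm_p le_p] opt]]]] :=
  @mu2_prog_correct R d th mm _ _ th_decr le_deg
    (input theta m (min_degree E) (max_degree E)).
  by split.
exists t, s; split=> //; first by rewrite (leq_trans le_t) // leq_mul2l.
split=> [|q /(feasible_admissible q v0 symE irrE) adm_q]; last by rewrite -costE opt.
exists p; first exact/(feasible_admissible p v0 symE irrE).
(* The witness costs at most the output, and optimality applied to the witness itself gives the
   converse. *)
by rewrite -costE; apply/eqP; rewrite eqn_leq le_p opt.
Qed.
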